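(* Let $\langle X_1,\tau_1\rangle$ and $\langle X_2,\tau_2\rangle$ be topological spaces. If $f$ is a BCA-isomorphism of the contact algebras $\mathfrak{B}_1=\langle \mathrm{RC}(\tau_1),\mathsf{C}_{\tau_1}\rangle$ and $\mathfrak{B}_2=\langle \mathrm{RC}(\tau_2),\mathsf{C}_{\tau_2}\rangle$, but $f$ does not preserve interior-connectedness, then both algebras $\mathfrak{B}_1$ and $\mathfrak{B}_2$ must have at least eight elements.
   Context: For a topological space $\langle X,\tau\rangle$ ($\tau$ the family of open sets), a subset $A\subseteq X$ is regular closed if $A=\overline{\operatorname{Int} A}$. $\mathrm{RC}(\tau)$ denotes the (complete) Boolean algebra of all regular closed subsets of $X$, ordered by inclusion, with join $A\cup D$, meet $A\cdot D=\overline{\operatorname{Int}(A\cap D)}$, complement $-A=\overline{X\setminus A}$, zero $\emptyset$ and unity $X$. The topological contact relation on $\mathrm{RC}(\tau)$ is defined by: $A\mathrel{\mathsf{C}_\tau} D$ if and only if $A\cap D\neq\emptyset$ (set-theoretical intersection). A BCA-isomorphism from $\langle B_1,\mathsf{C}_1\rangle$ to $\langle B_2,\mathsf{C}_2\rangle$ (Boolean algebras equipped with contact relations) is a Boolean algebra isomorphism $f\colon B_1\to B_2$ such that for all $x,y\in B_1$: $x\mathrel{\mathsf{C}_1}y$ if and only if $f(x)\mathrel{\mathsf{C}_2}f(y)$. A subset $A$ of a topological space $X$ is interior-connected if its interior $\operatorname{Int} A$ is a connected subspace of $X$. A BCA-isomorphism $f\colon \mathrm{RC}(\tau_1)\to \mathrm{RC}(\tau_2)$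 preserves interior-connectedness if for all $b\in \mathrm{RC}(\tau_1)$: $b$ has a connected interior in $X_1$ if and only if $f(b)$ has a connected interior in $X_2$. *)

(* Defs.v *)
From HB Require Import structures.
From mathcomp Require Import all_boot all_order.
From mathcomp Require Import boolp classical_sets cardinality topology.

Set Implicit Arguments.
Unset Strict Implicit.
Unset Printing Implicit Defensive.

Import Order.TTheory.

Local Open Scope classical_set_scope.

Record RC (X : topologicalType) := MkRC {
  rc_set :> set X;
  rc_regclosed : regclosed rc_set
}.

HB.instance Definition _ (X : topologicalType) := gen_eqMixin (RC X).
HB.instance Definition _ (X : topologicalType) := gen_choiceMixin (RC X).

Fact rc_display : Order.disp_t. Proof. exact: Order.Disp tt tt. Qed.

Section RCAlgebra.
Variable X : topologicalType.
Implicit Types A B C : RC X.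

Lemma rc_inj A B : rc_set A = rc_set B -> A = B.
Proof.
case: A B => [A hA] [B hB] /= eAB; move: hA hB; rewrite eAB => hA hB.
by congr MkRC; exact: Prop_irrelevance.
Qed.

Lemma regclosedU (A B : set X) :
  regclosed A -> regclosed B -> regclosed (A `|` B).
Proof.
move=> hA hB; rewrite /regclosed eqEsubset; split.
  have cA : closed A by rewrite -hA; exact: closed_closure.
  have cB : closed B by rewrite -hB; exact: closed_closure.
  apply: (subset_trans (closureS (@interior_subset _ _))).
  by rewrite closureU; exact: setUSS.
rewrite -[X in X `|` _ `<=` _]hA -[X in _ `|` X `<=` _]hB -closureU.
exact/closureS/interiorU.
Qed.

Definition rc_join A B : RC X :=
  MkRC (regclosedU (rc_regclosed A) (rc_regclosed B)).

Definition rc_meet A B : RC X :=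
  MkRC (closure_open_regclosed (@open_interior _ (A `&` B))).

Lemma regclosed_closureC A : regclosed (closure (~` A)).
Proof.
rewrite /regclosed -[in RHS](rc_regclosed A) -interiorC.
by rewrite closure_setC -(closure_setC A).
Qed.

Definition rc_compl A : RC X := MkRC (regclosed_closureC A).

Lemma regclosed0 : regclosed (set0 : set X).
Proof. by rewrite /regclosed interior0 closure0. Qed.

Lemma regclosedT : regclosed (setT : set X).
Proof. by rewrite /regclosed interiorT closureT. Qed.

Definition rc_bot : RC X := MkRC regclosed0.
Definition rc_top : RC X := MkRC regclosedT.

Definition rc_le A B : bool := `[< A `<=` B >].

Lemma rc_le_refl : reflexive rc_le.
Proof. by move=> A; exact/asboolP. Qed.

Lemma rc_le_anti : antisymmetric rc_le.
Proof.
move=> A B /andP[/asboolP AB /asboolP BA].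
by apply: rc_inj; rewrite eqEsubset.
Qed.

Lemma rc_le_trans : transitive rc_le.
Proof.
by move=> B A C /asboolP AB /asboolP BC; apply/asboolP; exact: subset_trans BC.
Qed.

HB.instance Definition _ := Order.Le_isPOrder.Build rc_display (RC X)
  rc_le_refl rc_le_anti rc_le_trans.

Lemma rc_leP A B : reflect (A `<=` B) (A <= B)%O.
Proof. exact: asboolP. Qed.

Lemma rc_meetP A B C : (A <= rc_meet B C)%O = (A <= B)%O && (A <= C)%O.
Proof.
apply/rc_leP/andP => /= [h|[/rc_leP AB /rc_leP AC]].
  split; apply/rc_leP; apply: (subset_trans h).
    rewrite -[X in _ `<=` X](rc_regclosed B).
    by apply/closureS/interiorS => x [].
  rewrite -[X in _ `<=` X](rc_regclosed C).
  by apply/closureS/interiorS => x [].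
rewrite -[X in X `<=` _](rc_regclosed A); apply/closureS/interiorS.
by rewrite subsetI.
Qed.

Lemma rc_joinP A B C : (rc_join A B <= C)%O = (A <= C)%O && (B <= C)%O.
Proof.
apply/rc_leP/andP => /= [|[/rc_leP AC /rc_leP BC]].
  rewrite subUset => -[AC BC].
  by split; exact/rc_leP.
by rewrite subUset.
Qed.

HB.instance Definition _ := Order.POrder_MeetJoin_isLattice.Build
  rc_display (RC X) rc_meetP rc_joinP.

Lemma rc_meetUl : @left_distributive (RC X) (RC X) Order.meet Order.join.
Proof.
move=> A B C; apply/le_anti/andP; split; last first.
  by rewrite leUx !lexI !leIr !andbT !(le_trans (leIl _ _)) ?leUl ?leUr.
apply/rc_leP => /=; rewrite -closureU.
apply: (subset_trans _ (@closed_closure _ _)).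
apply: closureS; rewrite closureU !interiorI => x [xAB xC].
have half (D : RC X) : rc_set D x -> closure (D° `&` C°) x.
  rewrite -{1}(rc_regclosed D) => Dx V Vx.
  have [|y [Dy [Vy Cy]]] := Dx (V `&` C°); last by exists y.
  by apply: filterI => //; exact: nbhs_interior.
by have [/half|/half] := interior_subset xAB; [left|right].
Qed.

HB.instance Definition _ := Order.Lattice_Meet_isDistrLattice.Build
  rc_display (RC X) rc_meetUl.

Lemma rc_le0x A : (rc_bot <= A)%O.
Proof. by apply/rc_leP => ?. Qed.

Lemma rc_lex1 A : (A <= rc_top)%O.
Proof. by apply/rc_leP => ?. Qed.

HB.instance Definition _ := Order.hasBottom.Build rc_display (RC X) rc_le0x.
HB.instance Definition _ := Order.hasTop.Build rc_display (RC X) rc_lex1.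

Lemma rc_joinxC A : (A `|` rc_compl A)%O = \top%O.
Proof.
apply/le_anti; rewrite lex1 /=; apply/rc_leP => x _ /=.
by have [Ax|nAx] := pselect (rc_set A x); [left|right; exact: subset_closure].
Qed.

Lemma rc_meetxC A : (A `&` rc_compl A)%O = \bot%O.
Proof.
apply/le_anti; rewrite le0x andbT; apply/rc_leP => /=.
rewrite -[X in _ `<=` X]closure0; apply: closureS.
by rewrite interiorI closure_setC => x [Ax /interior_subset].
Qed.

HB.instance Definition _ := Order.TBDistrLattice_hasComplement.Build
  rc_display (RC X) rc_joinxC rc_meetxC.

Lemma rc_leE A B : (A <= B)%O = `[< A `<=` B >].
Proof. by []. Qed.

Lemma rc_joinE A B : rc_set (A `|` B)%O = rc_set A `|` rc_set B.
Proof. by []. Qed.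

Lemma rc_meetE A B :
  rc_set (A `&` B)%O = closure ((rc_set A `&` rc_set B)°).
Proof. by []. Qed.

Lemma rc_complE A : rc_set (~` A)%O = closure (~` rc_set A).
Proof. by []. Qed.

Lemma rc_botE : rc_set (\bot%O : RC X) = set0.
Proof. by []. Qed.

Lemma rc_topE : rc_set (\top%O : RC X) = setT.
Proof. by []. Qed.

End RCAlgebra.

(* The set-theoretic intersection, not the meet of [RC X]. *)
Definition contact (X : topologicalType) (A B : RC X) : Prop :=
  A `&` B !=set0.

Section Isomorphism.
Context {d1 d2 : Order.disp_t}.
Variables (B1 : ctbDistrLatticeType d1) (B2 : ctbDistrLatticeType d2).

Record boolean_isomorphism (f : B1 -> B2) : Prop := {
  biso_bij : bijective f;
  biso_meet : forall x y, f (x `&` y)%O = (f x `&` f y)%O;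
  biso_join : forall x y, f (x `|` y)%O = (f x `|` f y)%O;
  biso_compl : forall x, f (~` x)%O = (~` f x)%O;
  biso_bot : f \bot%O = \bot%O;
  biso_top : f \top%O = \top%O
}.

Definition bca_isomorphism (C1 : B1 -> B1 -> Prop) (C2 : B2 -> B2 -> Prop)
    (f : B1 -> B2) : Prop :=
  boolean_isomorphism f /\ forall x y, C1 x y <-> C2 (f x) (f y).

End Isomorphism.

(* [connected] counts the empty set as connected. *)
Definition interior_connected (X : topologicalType) (A : set X) : Prop :=
  connected A°.

Definition preserves_interior_connectedness (X1 X2 : topologicalType)
    (f : RC X1 -> RC X2) : Prop :=
  forall b : RC X1, interior_connected b <-> interior_connected (f b).

(* Main.v *)
Require Import Defs.
From mathcomp Require Import all_boot all_order.
From mathcomp Require Import boolp classical_sets cardinality topology.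

Import Order.Theory.

Local Open Scope classical_set_scope.
Local Open Scope card_scope.

(** A Boolean algebra with fewer than eight elements has no three nonzero,
    pairwise disjoint elements, because the joins of subfamilies of such a
    triple are eight distinct elements ([card_disjoint_family], [card_ge8]).

    Suppose that the interior of a regular closed set [b] is disconnected, and
    let [U], [V] be two nonempty disjoint open sets whose union is that
    interior.  The closures of [U] and [V] are nonzero elements of the algebra
    with join [b] and meet zero, although they may share boundary points
    ([disconnected_interior_split]).  If [b] is not the unity, the complement of
    [b] is a third nonzero element, disjoint from both, and the algebra has at
    least eight elements; the isomorphism, being a bijection, transfers this to
    the other algebra.  Finally, for the unity preservation is automatic: a
    space is disconnected if and only if its unity is the join of two nonzero
    elements that are not in contact ([disconnected_topP]), and an isomorphism
    of contact algebras respects this condition.  So a failure of preservation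
    at [b] forces [b] to differ from the unity. *)

Lemma card_le_inj (T U : Type) (A : set T) (f : T -> U) :
  {in A &, injective f} -> A #<= [set: U].
Proof.
move=> finj; apply: (@card_le_trans _ _ _ (f @` A)); last exact: subset_card_le.
by have := inj_card_eq finj; rewrite card_eq_sym card_eq_le => /andP[].
Qed.

(** The joins of the subfamilies are pairwise distinct, because [i] belongs to
    [S] exactly when [g i] lies below the join of [g] over [S]. *)
Lemma card_disjoint_family (d : Order.disp_t) (B : bDistrLatticeType d)
    (n : nat) (g : 'I_n -> B) :
  (forall i, g i <> \bot%O) ->
  (forall i j, i != j -> (g i `&` g j = \bot)%O) ->
  `I_(2 ^ n) #<= [set: B].
Proof.
move=> g_neq0 g_disj.
pose F (S : {set 'I_n}) : B := (\join_(i in S) g i)%O.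
have memF i (S : {set 'I_n}) : (i \in S) = (g i <= F S)%O.
  apply/idP/idP => [iS|gi_le]; first by apply: joins_sup.
  apply: contrapT => iNS; apply: (g_neq0 i).
  rewrite -(meet_idPl gi_le).
  apply: joins_disjoint => j jS; apply: g_disj.
  by apply: contra_notN iNS => /eqP ->.
have Finj : injective F by move=> S T FST; apply/setP => i; rewrite !memF FST.
have sz : size (enum {set 'I_n}) = 2 ^ n.
  by rewrite -cardE -cardsT -powersetT card_powerset cardsT card_ord.
apply: (@card_le_inj _ _ _ (fun k => F (nth finset.set0 (enum {set 'I_n}) k))).
move=> k l; rewrite !inE /= => kn ln /Finj/eqP.
by rewrite nth_uniq ?enum_uniq ?sz // => /eqP.
Qed.

(** The three disjoint elements are [x], [y] and the complement of their join. *)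
Lemma card_ge8 (d : Order.disp_t) (B : ctbDistrLatticeType d) (x y : B) :
  x <> \bot%O -> y <> \bot%O -> (x `&` y = \bot)%O -> (x `|` y)%O <> \top%O ->
  `I_8 #<= [set: B].
Proof.
move=> x0 y0 xy0 xy1.
pose z : B := (~` (x `|` y))%O.
have z0 : z <> \bot%O.
  by move=> zE; apply: xy1; rewrite -[LHS]complK -/z zE compl0.
have xz : (x `&` z = \bot)%O.
  by rewrite /z complU meetA meetxC meet0x.
have yz : (y `&` z = \bot)%O.
  by rewrite /z complU meetCA meetxC meetx0.
apply: (@card_disjoint_family _ B 3 (fun i => nth z [:: x; y; z] i)).
  by case=> -[|[|[|]]].
by case=> -[|[|[|i]]] hi // [[|[|[|j]]] hj] //= _; rewrite // meetC.
Qed.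

Lemma open_separatedl {X : topologicalType} {U V : set X} :
  open (U `|` V) -> separated U V -> open U.
Proof.
move=> oUV [_ sepR].
have -> : U = (U `|` V) `&` ~` closure V.
  rewrite eqEsubset; split => [x Ux|x [[//|Vx] nVx]].
    by split; [left|move=> Vx; rewrite -[False]/(set0 x) -sepR].
  by case: nVx; exact: subset_closure.
by apply: openI => //; apply/closed_openC/closed_closure.
Qed.

Lemma open_separatedr {X : topologicalType} {U V : set X} :
  open (U `|` V) -> separated U V -> open V.
Proof.
by rewrite setUC separatedC; exact: open_separatedl.
Qed.

Lemma rc_neq0 {X : topologicalType} (A : RC X) : A <> \bot%O <-> A !=set0.
Proof.
split=> [A0|[x Ax] A0]; last by rewrite A0 in Ax.
by apply/set0P/eqP => AE; apply: A0; exact: rc_inj.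
Qed.

Lemma disconnected_interior_split (X : topologicalType) (b : RC X) :
  ~ interior_connected b ->
  exists x y : RC X,
    [/\ x <> \bot%O, y <> \bot%O, (x `&` y = \bot)%O & (x `|` y = b)%O].
Proof.
move=> /connectedPn[E [E0 bE sepE]].
have oUV : open (E false `|` E true) by rewrite -bE; exact: open_interior.
have oU := open_separatedl oUV sepE; have oV := open_separatedr oUV sepE.
exists (MkRC (closure_open_regclosed oU)), (MkRC (closure_open_regclosed oV)); split.
- by apply/rc_neq0; have [x Ux] := E0 false; exists x; exact: subset_closure.
- by apply/rc_neq0; have [x Vx] := E0 true; exists x; exact: subset_closure.
- apply: rc_inj; rewrite rc_meetE /= -[RHS]closure0.
  congr (closure _); apply/seteqP; split=> // x xI.
  (* An interior point of both closures is a limit of points of [U], and such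
     points near it lie in the closure of [V], against separation. *)
  have [Ux _] := interior_subset xI.
  have [y [Uy /interior_subset[_ Vy]]] :=
    Ux _ (open_nbhs_nbhs (conj (@open_interior _ _) xI)).
  by suff : set0 y by []; rewrite -sepE.2.
- by apply: rc_inj; rewrite rc_joinE /= -closureU -bE; exact: rc_regclosed.
Qed.

(** The sides of a disconnection of the whole space are clopen, hence already
    regular closed and disjoint as sets.  For a proper regular closed set the
    closures of the two sides of its interior may meet, so that contact does not
    detect the disconnection. *)
Lemma disconnected_topP (X : topologicalType) :
  ~ interior_connected (\top%O : RC X) <->
  exists x y : RC X,
    [/\ x <> \bot%O, y <> \bot%O, (x `|` y = \top)%O & ~ contact x y].
Proof.
rewrite /interior_connected rc_topE interiorT; split.
  move=> /connectedPn[E [E0 TE sepE]].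
  have oUV : open (E false `|` E true) by rewrite -TE; exact: openT.
  have oU := open_separatedl oUV sepE; have oV := open_separatedr oUV sepE.
  have UV0 : E false `&` E true = set0 by exact: separated_disjoint.
  have UE : E false = ~` E true.
    apply/seteqP; split=> x => [Ux Vx|nVx].
      by rewrite -[False]/(set0 x) -UV0.
    by have : setT x by []; rewrite TE => -[].
  have rcU : regclosed (E false).
    rewrite /regclosed (interior_id _).1 // -(closure_id _).1 // UE.
    exact: open_closedC.
  have rcV : regclosed (E true).
    rewrite /regclosed (interior_id _).1 // -(closure_id _).1 //.
    by rewrite -[E true]setCK -UE; exact: open_closedC.
  exists (MkRC rcU), (MkRC rcV); split; [exact/rc_neq0/E0|exact/rc_neq0/E0| |].
  - by apply: rc_inj; rewrite rc_joinE /= -TE.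
  - by rewrite /contact /= UV0 => -[? []].
move=> [x [y [/rc_neq0 x0 /rc_neq0 y0 xyT xyC]]]; apply/connectedPn.
have rc_closed (A : RC X) : closure A = A.
  by rewrite -(closure_id _).1 // -(rc_regclosed A); exact: closed_closure.
have xy0 : x `&` y = set0 by apply/eqP/negPn/negP => /set0P.
exists (fun i : bool => if i then rc_set y else rc_set x); split.
- by case.
- by rewrite -rc_joinE xyT.
- by split; rewrite rc_closed.
Qed.

Lemma bca_isomorphism_disconnected_top (X1 X2 : topologicalType)
    (f : RC X1 -> RC X2) :
  bca_isomorphism (@contact X1) (@contact X2) f ->
  ~ interior_connected (\top%O : RC X1) <->
  ~ interior_connected (\top%O : RC X2).
Proof.
move=> [[[g fK gK] _ fU _ f0 f1] fC]; rewrite !disconnected_topP.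
split=> -[x [y [x0 y0 xy1 xyC]]].
  exists (f x), (f y); split.
  - by rewrite -f0 => /(can_inj fK).
  - by rewrite -f0 => /(can_inj fK).
  - by rewrite -fU xy1.
  - by rewrite -fC.
exists (g x), (g y); split.
- by move=> gx0; apply: x0; rewrite -[x]gK gx0.
- by move=> gy0; apply: y0; rewrite -[y]gK gy0.
- by apply: (can_inj fK); rewrite fU !gK f1.
- by rewrite fC !gK.
Qed.

Lemma disconnected_interior_card_ge8 (X : topologicalType) (b : RC X) :
  ~ interior_connected b -> b <> \top%O -> `I_8 #<= [set: RC X].
Proof.
by move=> /disconnected_interior_split[x [y [x0 y0 xy0 <-]]]; exact: card_ge8.
Qed.

Theorem theorem3p1 (X1 X2 : topologicalType) (f : RC X1 -> RC X2) :
  bca_isomorphism (@contact X1) (@contact X2) f ->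
  ~ preserves_interior_connectedness f ->
  (`I_8 #<= [set: RC X1]) /\ (`I_8 #<= [set: RC X2]).
Proof.
move=> fiso fN.
have [[[g fK gK] _ _ _ _ f1] _] := fiso.
suff [le1|le2] : `I_8 #<= [set: RC X1] \/ `I_8 #<= [set: RC X2].
- split=> //; apply: card_le_trans le1 _.
  by apply: (@card_le_inj _ _ _ f) => x y _ _ /(can_inj fK).
- split=> //; apply: card_le_trans le2 _.
  by apply: (@card_le_inj _ _ _ g) => x y _ _ /(can_inj gK).
apply: contrapT => /not_orP[small1 small2]; apply: fN => b.
have [->|b1] := pselect (b = \top%O).
  by rewrite f1; have [h12 h21] := bca_isomorphism_disconnected_top _ _ _ fiso;
    split=> hc; apply: contrapT => hd; [exact: h21 hd hc|exact: h12 hd hc].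
have fb1 : f b <> \top%O by rewrite -f1 => /(can_inj fK).
split=> _; apply: contrapT => hd.
- exact: small2 (disconnected_interior_card_ge8 _ _ hd fb1).
- exact: small1 (disconnected_interior_card_ge8 _ _ hd b1).
Qed.
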